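(* Let $\varphi$ be a bounded, Riemann integrable function defined on an interval $I=[a,b]$ that does not change sign on $I$, and let $\Phi$ be an indefinite integral of $\varphi$ on $I$. Let $\psi$ be a bounded, Riemann integrable function defined on $\Phi(I)$, the range of $\Phi$, and let $\Psi$ be an indefinite integral of $\psi$ on $\Phi(I)$. If a bounded function $f$ defined on $\Phi(I)$ is Riemann integrable with respect to $\Psi$ on $\Phi(I)$, then the function $x\mapsto f(\Phi(x))\,\psi(\Phi(x))$ is Riemann integrable with respect to $\Phi$ on $I$, and in that case, with the oriented interval $\mathcal I=[\Phi(a),\Phi(b)]$, $$\int_{\mathcal I} f\, d\Psi=\int_I f(\Phi)\,\psi(\Phi)\, d\Phi .$$
   Context: $I=[a,b]$ is a closed finite interval of $\mathbb{R}$; all functions are real valued. A function does not change sign if it is everywhere $\ge 0$ or everywhere $\le 0$ on its domain. That $\Phi$ is an indefinite integral of $\varphi$ on $I$ means $\Phi(x)=\Phi(a)+\int_a^x\varphi$ for all $x\in I$, with $\Phi(a)\in\mathbb{R}$ arbitrary; $\Phi$ is continuous, so $\Phi(I)$ is a closed bounded interval (possibly a single point). That $\Psi$ is an indefinite integral of $\psi$ on $\Phi(I)$ means $\Psi(y)=\Psi(\Phi(a))+\int_{\Phi(a)}^{y}\psi$ for all $y\in\Phi(I)$, where the Riemann integral is oriented ($\int_s^t=-\int_t^s$). The notation $f(\Phi)$ means $f\circ\Phi$, and $\psi(\Phi)$ means $\psi\circ\Phi$. Integrability with respect to an integrator: let $c\le d$, let $g$ be a bounded function on $[c,d]$ and $\Theta$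 a function on $[c,d]$. Then $g$ is Riemann integrable with respect to $\Theta$ on $[c,d]$, with integral $\int_{[c,d]}g\,d\Theta=A\in\mathbb{R}$, if for every $\varepsilon>0$ there is a partition $\mathcal P_\varepsilon$ of $[c,d]$ such that for every partition $c=x_0\le x_1\le\dots\le x_n=d$ refining $\mathcal P_\varepsilon$ and all $\xi_k\in[x_{k-1},x_k]$ one has $\big|\sum_{k=1}^n g(\xi_k)(\Theta(x_k)-\Theta(x_{k-1}))-A\big|\le\varepsilon$. When $\Theta$ is continuous and increasing this is equivalent to $U(g,\Theta)=L(g,\Theta)$, with $A$ the common value, where $U(g,\Theta)=\inf_{\mathcal P}\sum_k(\sup_{[x_{k-1},x_k]}g)(\Theta(x_k)-\Theta(x_{k-1}))$ and $L(g,\Theta)=\sup_{\mathcal P}\sum_k(\inf_{[x_{k-1},x_k]}g)(\Theta(x_k)-\Theta(x_{k-1}))$. If $c=d$, every $g$ is integrable with integral $0$. Integrals are oriented: if $\Phi(a)>\Phi(b)$, then $\int_{[\Phi(a),\Phi(b)]}f\,d\Psi=-\int_{[\Phi(b),\Phi(a)]}f\,d\Psi$. *)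

(* Defs.v *)
(* Stdlib reals, with Coquelicot for the Riemann integral. *)
From Stdlib Require Export Reals.
From Coquelicot Require Export Coquelicot.
From Stdlib Require Import Lra Lia List RList.

Open Scope R_scope.

(* Functions on a subset D of R are total functions whose values outside D are
   never consulted. *)

Definition segment (c d : R) : R -> Prop := fun x => c <= x <= d.

Definition bounded_on (D : R -> Prop) (f : R -> R) : Prop :=
  exists M : R, forall x : R, D x -> Rabs (f x) <= M.

Definition no_sign_change_on (D : R -> Prop) (f : R -> R) : Prop :=
  (forall x : R, D x -> 0 <= f x) \/ (forall x : R, D x -> f x <= 0).

(* [RInt] is oriented, so the base point [s] may be any point of [D]. *)
Definition indefinite_integral (D : R -> Prop) (s : R) (F f : R -> R) : Prop :=
  forall x : R, D x -> F x = F s + RInt f s x.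

(* A partition has n+1 subintervals, with division points
   c = p 0 <= ... <= p (n+1) = d.  Repeated points are allowed, so requiring at
   least one subinterval is harmless, also when c = d. *)
Definition is_partition (c d : R) (n : nat) (p : nat -> R) : Prop :=
  p 0%nat = c /\ p (S n) = d /\
  (forall k : nat, (k <= n)%nat -> p k <= p (S k)).

Definition refines (n : nat) (p : nat -> R) (m : nat) (q : nat -> R) : Prop :=
  forall j : nat, (j <= S m)%nat -> exists i : nat, (i <= S n)%nat /\ p i = q j.

Definition RS_sum (g Theta : R -> R) (n : nat) (p xi : nat -> R) : R :=
  sum_f_R0 (fun k => g (xi k) * (Theta (p (S k)) - Theta (p k))) n.

(* For c <= d only: no partition exists when d < c. *)
Definition is_RSInt (g Theta : R -> R) (c d A : R) : Prop :=
  forall eps : R, 0 < eps ->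
    exists (m : nat) (q : nat -> R),
      is_partition c d m q /\
      forall (n : nat) (p xi : nat -> R),
        is_partition c d n p ->
        refines n p m q ->
        (forall k : nat, (k <= n)%nat -> p k <= xi k <= p (S k)) ->
        Rabs (RS_sum g Theta n p xi - A) <= eps.

Definition ex_RSInt (g Theta : R -> R) (c d : R) : Prop :=
  exists A : R, is_RSInt g Theta c d A.

(* The value of the oriented integral, in the style of [RInt]. *)
Definition RSInt (g Theta : R -> R) (s t : R) : R :=
  if Rle_dec s t then iota (is_RSInt g Theta s t)
  else - iota (is_RSInt g Theta t s).

Lemma partition_common_refinement (c d : R) (m1 m2 : nat) (q1 q2 : nat -> R) :
  is_partition c d m1 q1 -> is_partition c d m2 q2 ->
  exists (n : nat) (p : nat -> R),
    is_partition c d n p /\ refines n p m1 q1 /\ refines n p m2 q2.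
Proof.
assert (nthE : forall (q : nat -> R) (n s i : nat), (i < n)%nat ->
    pos_Rl (map q (seq s n)) i = q (s + i)%nat).
{ intros q n; induction n as [|n IH]; intros s i Hi; [lia|].
  destruct i as [|i]; simpl; [now rewrite Nat.add_0_r|].
  rewrite IH by lia; f_equal; lia. }
pose (l := fun (m : nat) (q : nat -> R) => map q (seq 0 (S (S m)))).
assert (lenE : forall m q, length (l m q) = S (S m)).
{ intros m q; unfold l; now rewrite length_map, length_seq. }
assert (lE : forall m q i, (i <= S m)%nat -> pos_Rl (l m q) i = q i).
{ intros m q i Hi; unfold l; rewrite nthE by lia; reflexivity. }
assert (lord : forall m q, is_partition c d m q -> ordered_Rlist (l m q)).
{ intros m q (_ & _ & Hq) i Hi; rewrite lenE in Hi; simpl in Hi.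
  rewrite !lE by lia; apply Hq; lia. }
intros H1 H2.
pose (L := cons_ORlist (l m1 q1) (l m2 q2)).
assert (lenL : length L = S (S (m1 + S (S m2)))).
{ unfold L; rewrite RList_P11, !lenE; lia. }
assert (Lref : forall m q, (forall x, In x (l m q) -> In x L) ->
    refines (m1 + S (S m2)) (pos_Rl L) m q).
{ intros m q Hin j Hj.
  destruct (proj1 (RList_P3 L (q j))) as [i [Hi1 Hi2]].
  { apply Hin; apply RList_P3; exists j; rewrite lE, lenE by lia; split; [easy|lia]. }
  exists i; split; [lia|easy]. }
exists (m1 + S (S m2))%nat, (pos_Rl L); split; [|split].
- pose proof (lord _ _ H1) as O1; pose proof (lord _ _ H2) as O2.
  pose proof H1 as (a1 & b1 & _); pose proof H2 as (a2 & b2 & _).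
  split; [|split].
  + unfold L; rewrite RList_P15; trivial; rewrite !lE by lia; congruence.
  + replace (S (m1 + S (S m2))) with (pred (length L)) by lia.
    unfold L; rewrite RList_P16; trivial; rewrite !lenE; simpl pred;
      rewrite !lE by lia; congruence.
  + intros k Hk; apply (RList_P2 _ _ O2); fold L; lia.
- apply Lref; intros x Hx; apply RList_P9; now left.
- apply Lref; intros x Hx; apply RList_P9; now right.
Qed.

Lemma is_RSInt_inj (g Theta : R -> R) (c d A B : R) :
  is_RSInt g Theta c d A -> is_RSInt g Theta c d B -> A = B.
Proof.
intros HA HB; apply cond_eq; intros eps Heps.
destruct (HA (eps / 3)) as (m1 & q1 & P1 & S1); [lra|].
destruct (HB (eps / 3)) as (m2 & q2 & P2 & S2); [lra|].
destruct (partition_common_refinement _ _ _ _ _ _ P1 P2) as (n & p & Pp & R1 & R2).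
assert (T : forall k : nat, (k <= n)%nat -> p k <= p k <= p (S k)).
{ intros k Hk; split; [lra|now apply Pp]. }
specialize (S1 n p p Pp R1 T); specialize (S2 n p p Pp R2 T).
apply Rabs_def1; apply Rabs_le_between in S1; apply Rabs_le_between in S2; lra.
Qed.

Lemma RSInt_unique (g Theta : R -> R) (c d A : R) :
  c <= d -> is_RSInt g Theta c d A -> RSInt g Theta c d = A.
Proof.
intros Hcd HA; unfold RSInt; destruct (Rle_dec c d) as [_|]; [|easy].
apply (iota_unique (V := R_CompleteNormedModule)); [|exact HA].
intros B HB; exact (is_RSInt_inj _ _ _ _ _ _ HB HA).
Qed.

Lemma RSInt_swap (g Theta : R -> R) (s t A : R) :
  t < s -> is_RSInt g Theta t s A -> RSInt g Theta s t = - A.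
Proof.
intros Hts HA; unfold RSInt; destruct (Rle_dec s t) as [|_]; [lra|].
f_equal; rewrite <- (RSInt_unique g Theta t s A); [|lra|exact HA].
unfold RSInt; destruct (Rle_dec t s) as [_|]; [easy|lra].
Qed.

(* Main.v *)
Require Import Defs.
From Stdlib Require Import Lra Lia Classical IndefiniteDescription.

(** The change of variable is a term-by-term identity between sums. Since
    [Phi] is monotone and maps [a, b] onto [c, d], a tagged partition of [a, b]
    is carried by [Phi] to a tagged partition of [c, d], and the sum of
    [h o Phi] with integrator [Phi] on the former is the sum of [h] with the
    identity integrator on the latter. Every partition of [c, d] lifts to one
    of [a, b], so integrability passes from [h] to [h o Phi]
    ([is_RSInt_comp]). When [phi <= 0], the argument runs with [- Phi] and the
    reflected function [h (- y)] ([is_RSInt_reflect]), and the sign of the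
    integral changes, matching the reversed orientation of
    [[Phi a, Phi b]].

    It remains to pass from [f dPsi] to [f psi dy] on [c, d], that is to take
    [h = f psi] ([is_RSInt_density]). As [f] is bounded, it is enough that the
    errors [Psi x_k - Psi x_(k-1) - psi xi_k (x_k - x_(k-1))] be absolutely
    summable to at most [eps] on all fine partitions
    ([fine_sum_absolute_errors]). The definition of the Riemann integral bounds
    only their signed sum, but uniformly in the tags, and a suitable choice of
    tags makes the signed sum control the positive parts
    ([fine_sum_positive_errors]); negating [psi] gives the negative parts. *)

(** * Finite sums and partitions *)

Lemma sum_f_R0_shift (u : nat -> R) (n : nat) :
  sum_f_R0 u (S n) = u 0%nat + sum_f_R0 (fun k => u (S k)) n.
Proof. now rewrite decomp_sum by lia. Qed.

Lemma sum_f_R0_telescope (F : nat -> R) (n : nat) :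
  sum_f_R0 (fun k => F (S k) - F k) n = F (S n) - F 0%nat.
Proof. induction n as [|n IH]; simpl; [|rewrite IH]; ring. Qed.

Lemma partition_le (c d : R) (n : nat) (p : nat -> R) :
  is_partition c d n p ->
  forall i j : nat, (i <= j <= S n)%nat -> p i <= p j.
Proof.
intros (_ & _ & Hp) i j [Hij Hj]; induction Hij as [|j Hij IH]; [lra|].
apply Rle_trans with (p j); [apply IH|apply Hp]; lia.
Qed.

Lemma partition_in (c d : R) (n : nat) (p : nat -> R) (k : nat) :
  is_partition c d n p -> (k <= S n)%nat -> c <= p k <= d.
Proof.
intros Hp Hk; pose proof Hp as (H0 & H1 & _).
rewrite <- H0, <- H1; split; apply (partition_le _ _ _ _ Hp); lia.
Qed.

Lemma partition_locate (q : nat -> R) (x : R) (m : nat) :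
  q 0%nat <= x -> q m <= x \/ exists j : nat, (j < m)%nat /\ q j <= x < q (S j).
Proof.
intros H0; induction m as [|m [IH|(j & Hj & Hx)]]; [now left| |].
- destruct (Rle_lt_dec (q (S m)) x) as [H|H]; [now left|right].
  exists m; split; [lia|lra].
- right; exists j; split; [lia|exact Hx].
Qed.

(** No division point of the coarse partition lies strictly inside a
    subinterval of the fine one. *)
Lemma refines_mesh (c d delta : R) (m n : nat) (q p : nat -> R) :
  0 < delta ->
  is_partition c d m q -> is_partition c d n p -> refines n p m q ->
  (forall j : nat, (j <= m)%nat -> q (S j) - q j < delta) ->
  forall k : nat, (k <= n)%nat -> p (S k) - p k < delta.
Proof.
intros Hdelta Hq Hp Hr Hmesh k Hk.
pose proof Hq as (q0 & q1 & _).
pose proof (partition_in _ _ _ _ k Hp ltac:(lia)) as Hpk.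
pose proof (partition_in _ _ _ _ (S k) Hp ltac:(lia)) as HpSk.
destruct (partition_locate q (p k) (S m)) as [H|(j & Hj & Hx)]; [lra|lra|].
destruct (Hr (S j)) as (i & Hi & Hpi); [lia|].
assert (Hki : (k < i)%nat).
{ destruct (Nat.le_gt_cases i k) as [Hik|Hik]; [|exact Hik].
  pose proof (partition_le _ _ _ _ Hp i k ltac:(lia)); lra. }
pose proof (partition_le _ _ _ _ Hp (S k) i ltac:(lia)).
specialize (Hmesh j ltac:(lia)); lra.
Qed.

Lemma fine_partition (c d delta : R) :
  c <= d -> 0 < delta ->
  exists (m : nat) (q : nat -> R), is_partition c d m q /\
    forall j : nat, (j <= m)%nat -> q (S j) - q j < delta.
Proof.
intros Hcd Hdelta.
destruct (archimed_cor1 (delta / (d - c + 1))) as (N & HN & HN0).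
{ apply Rdiv_lt_0_compat; lra. }
destruct N as [|m]; [lia|].
assert (HS : 0 < INR (S m)) by now apply lt_0_INR.
assert (Hstep : (d - c) / INR (S m) < delta).
{ apply (Rmult_lt_compat_r (d - c + 1)) in HN; [|lra].
  replace (delta / (d - c + 1) * (d - c + 1)) with delta in HN by (field; lra).
  pose proof (Rinv_0_lt_compat _ HS); unfold Rdiv; nra. }
assert (H0 : 0 <= (d - c) / INR (S m)) by (apply Rdiv_le_0_compat; lra).
exists m, (fun j => c + INR j * ((d - c) / INR (S m))).
assert (E : forall j, c + INR (S j) * ((d - c) / INR (S m))
  - (c + INR j * ((d - c) / INR (S m))) = (d - c) / INR (S m)).
{ intros j; rewrite (S_INR j); ring. }
split; [split; [|split]|].
- simpl; ring.
- field; lra.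
- intros k _; specialize (E k); lra.
- intros j _; rewrite E; exact Hstep.
Qed.

(** * Riemann sums over fine partitions *)

(** The tagged partition as a list, which is the form over which [is_RInt]
    takes its limit. *)
Fixpoint tagged_list (n : nat) (p xi : nat -> R) : @SF_seq R :=
  match n with
  | O => SF_cons (p 0%nat, xi 0%nat) (SF_nil (p 1%nat))
  | S n => SF_cons (p 0%nat, xi 0%nat)
             (tagged_list n (fun k => p (S k)) (fun k => xi (S k)))
  end.

Lemma tagged_list_head (n : nat) (p xi : nat -> R) :
  SF_h (tagged_list n p xi) = p 0%nat.
Proof. now destruct n. Qed.

Lemma tagged_list_last (n : nat) : forall (p xi : nat -> R) (x : R),
  seq.last x (SF_lx (tagged_list n p xi)) = p (S n).
Proof.
induction n as [|n IH]; intros p xi x; [reflexivity|].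
cbn [tagged_list]; rewrite SF_lx_cons; exact (IH (fun k => p (S k)) _ (p 0%nat)).
Qed.

Lemma tagged_list_pointed (n : nat) : forall p xi : nat -> R,
  (forall k : nat, (k <= n)%nat -> p k <= xi k <= p (S k)) ->
  pointed_subdiv (tagged_list n p xi).
Proof.
assert (Hcons : forall x y (s : @SF_seq R), pointed_subdiv s -> x <= y <= SF_h s ->
    pointed_subdiv (SF_cons (x, y) s)).
{ intros x y s Hs Hxy [|i] Hi; [exact Hxy|].
  apply Hs; unfold SF_size in *; simpl in Hi; lia. }
induction n as [|n IH]; intros p xi Hxi; apply Hcons.
- intros i Hi; unfold SF_size in Hi; simpl in Hi; lia.
- now apply Hxi.
- apply IH; intros k Hk; apply Hxi; lia.
- rewrite tagged_list_head; apply Hxi; lia.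
Qed.

Lemma tagged_list_step (delta : R) (n : nat) : forall p xi : nat -> R,
  0 < delta ->
  (forall k : nat, (k <= n)%nat -> p k <= p (S k)) ->
  (forall k : nat, (k <= n)%nat -> p (S k) - p k < delta) ->
  seq_step (SF_lx (tagged_list n p xi)) < delta.
Proof.
assert (Hcons : forall x y (s : @SF_seq R), seq_step (SF_lx (SF_cons (x, y) s)) =
    Rmax (Rabs (SF_h s - x)) (seq_step (SF_lx s))) by reflexivity.
induction n as [|n IH]; intros p xi Hdelta Hp Hmesh;
  cbn [tagged_list]; rewrite Hcons; apply Rmax_lub_lt.
- specialize (Hp 0%nat ltac:(lia)); specialize (Hmesh 0%nat ltac:(lia)); simpl.
  rewrite Rabs_pos_eq; lra.
- exact Hdelta.
- specialize (Hp 0%nat ltac:(lia)); specialize (Hmesh 0%nat ltac:(lia)).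
  rewrite tagged_list_head, Rabs_pos_eq; lra.
- apply IH; [exact Hdelta| |]; intros k Hk; [apply Hp|apply Hmesh]; lia.
Qed.

Lemma tagged_list_sum (f : R -> R) (n : nat) : forall p xi : nat -> R,
  Riemann_sum f (tagged_list n p xi) = RS_sum f (fun x => x) n p xi.
Proof.
unfold RS_sum; induction n as [|n IH]; intros p xi;
  cbn [tagged_list]; rewrite Riemann_sum_cons.
- unfold Riemann_sum; simpl; unfold plus, scal, zero; simpl; unfold mult; simpl; ring.
- rewrite IH, sum_f_R0_shift, tagged_list_head.
  unfold plus, scal; simpl; unfold mult; simpl; ring.
Qed.

(** The degenerate interval is excluded because [is_RInt] multiplies the
    Riemann sums by the sign of [d - c]. *)
Lemma is_RInt_fine_sum (g : R -> R) (c d A eps : R) :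
  c < d -> is_RInt g c d A -> 0 < eps ->
  exists delta : R, 0 < delta /\
    forall (n : nat) (p xi : nat -> R),
      is_partition c d n p ->
      (forall k : nat, (k <= n)%nat -> p (S k) - p k < delta) ->
      (forall k : nat, (k <= n)%nat -> p k <= xi k <= p (S k)) ->
      Rabs (RS_sum g (fun x => x) n p xi - A) <= eps.
Proof.
intros Hcd HA Heps.
destruct (proj1 (filterlim_locally _ _) HA (mkposreal eps Heps)) as [delta Hd].
exists delta; split; [apply cond_pos|]; intros n p xi (H0 & H1 & Hp) Hmesh Hxi.
specialize (Hd (tagged_list n p xi)).
rewrite tagged_list_sum, (sign_eq_1 (d - c)) in Hd by lra.
assert (Hb : ball A eps (scal 1 (RS_sum g (fun x => x) n p xi))).
{ apply Hd.
  - now apply tagged_list_step; [apply cond_pos| |].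
  - split; [now apply tagged_list_pointed|].
    rewrite tagged_list_head, tagged_list_last, Rmin_left, Rmax_right by lra.
    now split. }
change (Rabs (1 * RS_sum g (fun x => x) n p xi - A) < eps) in Hb.
rewrite Rmult_1_l in Hb; lra.
Qed.

(** * Summing the absolute errors *)

(** Were every value of [g] on the interval too large by [eta], the integral
    would be too large as well. *)
Lemma low_tag (g : R -> R) (x y A eta : R) :
  x <= y -> 0 < eta -> is_RInt g x y A ->
  exists t : R, x <= t <= y /\ - (eta * (y - x)) <= A - g t * (y - x).
Proof.
intros Hxy Heta HA; apply NNPP; intros Hno.
assert (Hbig : forall t, x <= t <= y -> A + eta * (y - x) < g t * (y - x)).
{ intros t Ht; apply Rnot_le_lt; intros H; apply Hno; exists t; split; [exact Ht|lra]. }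
destruct (Req_dec x y) as [->|Hne].
- pose proof (is_RInt_unique _ _ _ _ HA) as HA0; rewrite RInt_point in HA0.
  change (0 = A) in HA0; specialize (Hbig y ltac:(lra)); nra.
- pose proof (is_RInt_const x y (A / (y - x) + eta : R)) as HC.
  assert (Hle : scal (y - x) (A / (y - x) + eta : R) <= A).
  { apply (is_RInt_le _ _ _ _ _ _ Hxy HC HA); intros t Ht.
    specialize (Hbig t ltac:(lra)).
    apply Rmult_le_reg_r with (y - x); [lra|].
    replace ((A / (y - x) + eta) * (y - x)) with (A + eta * (y - x))
      by (field; lra).
    lra. }
  change ((y - x) * (A / (y - x) + eta) <= A) in Hle.
  replace ((y - x) * (A / (y - x) + eta)) with (A + (y - x) * eta) in Hle
    by (field; lra).
  pose proof (Rmult_lt_0_compat (y - x) eta); lra.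
Qed.

(** The tags may be chosen independently on each subinterval: keeping those
    with a nonnegative error and replacing the others by tags of almost
    nonnegative error turns the sum of the positive parts into a single error
    of a Riemann sum. *)
Lemma fine_sum_positive_errors (g F : R -> R) (c d eps : R) :
  c < d ->
  (forall x y : R, c <= x <= d -> c <= y <= d -> is_RInt g x y (F y - F x)) ->
  0 < eps ->
  exists delta : R, 0 < delta /\
    forall (n : nat) (p xi : nat -> R),
      is_partition c d n p ->
      (forall k : nat, (k <= n)%nat -> p (S k) - p k < delta) ->
      (forall k : nat, (k <= n)%nat -> p k <= xi k <= p (S k)) ->
      sum_f_R0 (fun k => Rmax 0 (F (p (S k)) - F (p k)
                                  - g (xi k) * (p (S k) - p k))) n <= eps.
Proof.
intros Hcd HF Heps.
destruct (is_RInt_fine_sum g c d (F d - F c) (eps / 2)) as (delta & Hdelta & Hsum);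
  [exact Hcd|apply HF; lra|lra|].
exists delta; split; [exact Hdelta|]; intros n p xi Hp Hmesh Hxi.
(* An error of eta per unit length adds up to eps / 2 over [c, d]. *)
pose (eta := eps / 2 / (d - c)).
assert (Heta : 0 < eta) by (apply Rdiv_lt_0_compat; lra).
assert (Hzeta : forall k : nat, exists t : R, (k <= n)%nat ->
    p k <= t <= p (S k) /\
    Rmax 0 (F (p (S k)) - F (p k) - g (xi k) * (p (S k) - p k))
      - eta * (p (S k) - p k)
    <= F (p (S k)) - F (p k) - g t * (p (S k) - p k)).
{ intros k; destruct (Nat.le_gt_cases k n) as [Hk|Hk]; [|exists 0; lia].
  pose proof Hp as (_ & _ & Hmon); specialize (Hmon k Hk).
  destruct (Rle_lt_dec 0 (F (p (S k)) - F (p k) - g (xi k) * (p (S k) - p k)))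
    as [He|He].
  - exists (xi k); intros _; split; [now apply Hxi|].
    rewrite Rmax_right by exact He.
    pose proof (Rmult_le_pos eta (p (S k) - p k)); lra.
  - destruct (low_tag g (p k) (p (S k)) (F (p (S k)) - F (p k)) eta)
      as (t & Ht & Hlow); [exact Hmon|exact Heta| |].
    { apply HF; apply (partition_in _ _ _ _ _ Hp); lia. }
    exists t; intros _; split; [exact Ht|].
    rewrite Rmax_left by lra; lra. }
apply functional_choice in Hzeta; destruct Hzeta as (zeta & Hzeta).
specialize (Hsum n p zeta Hp Hmesh (fun k Hk => proj1 (Hzeta k Hk))).
pose proof (sum_Rle _ _ n (fun k Hk => proj2 (Hzeta k Hk))) as Hle.
rewrite !minus_sum in Hle.
pose proof Hp as (H0 & H1 & _).
assert (Eeta : sum_f_R0 (fun k => eta * (p (S k) - p k)) n = eps / 2).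
{ rewrite (sum_eq (fun k => eta * (p (S k) - p k)) (fun k => (p (S k) - p k) * eta) n
    (fun k _ => Rmult_comm _ _)).
  rewrite <- (scal_sum (fun k => p (S k) - p k)), (sum_f_R0_telescope p), H0, H1; unfold eta; field; lra. }
assert (EF : sum_f_R0 (fun k => F (p (S k))) n - sum_f_R0 (fun k => F (p k)) n
    = F d - F c).
{ now rewrite <- minus_sum, (sum_f_R0_telescope (fun k => F (p k))), H0, H1. }
unfold RS_sum in Hsum; apply Rabs_le_between in Hsum; lra.
Qed.

Lemma fine_sum_absolute_errors (g F : R -> R) (c d eps : R) :
  c < d ->
  (forall x y : R, c <= x <= d -> c <= y <= d -> is_RInt g x y (F y - F x)) ->
  0 < eps ->
  exists delta : R, 0 < delta /\
    forall (n : nat) (p xi : nat -> R),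
      is_partition c d n p ->
      (forall k : nat, (k <= n)%nat -> p (S k) - p k < delta) ->
      (forall k : nat, (k <= n)%nat -> p k <= xi k <= p (S k)) ->
      sum_f_R0 (fun k => Rabs (F (p (S k)) - F (p k)
                               - g (xi k) * (p (S k) - p k))) n <= eps.
Proof.
intros Hcd HF Heps.
destruct (fine_sum_positive_errors g F c d (eps / 2)) as (d1 & Hd1 & S1);
  [exact Hcd|exact HF|lra|].
destruct (fine_sum_positive_errors (fun t => - g t) (fun t => - F t) c d (eps / 2))
  as (d2 & Hd2 & S2); [exact Hcd| |lra|].
{ intros x y Hx Hy; replace (- F y - - F x) with (- (F y - F x)) by ring.
  now apply (is_RInt_opp (V := R_NormedModule)), HF. }
exists (Rmin d1 d2); split; [now apply Rmin_pos|]; intros n p xi Hp Hmesh Hxi.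
pose proof (Rmin_l d1 d2); pose proof (Rmin_r d1 d2).
assert (M1 : forall k, (k <= n)%nat -> p (S k) - p k < d1).
{ intros k Hk; specialize (Hmesh k Hk); lra. }
assert (M2 : forall k, (k <= n)%nat -> p (S k) - p k < d2).
{ intros k Hk; specialize (Hmesh k Hk); lra. }
specialize (S1 n p xi Hp M1 Hxi); specialize (S2 n p xi Hp M2 Hxi).
replace eps with (eps / 2 + eps / 2) by field.
eapply Rle_trans; [|exact (Rplus_le_compat _ _ _ _ S1 S2)].
rewrite <- plus_sum; apply sum_Rle; intros k _; cbv beta.
unfold Rabs, Rmax; destruct (Rcase_abs _); repeat destruct (Rle_dec _ _); lra.
Qed.

(** * Operations on the Riemann-Stieltjes integral *)

Lemma is_RSInt_point (g Theta : R -> R) (c : R) : is_RSInt g Theta c c 0.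
Proof.
intros eps Heps; exists 0%nat, (fun _ => c).
split; [split; [|split]; intros; lra|]; intros n p xi Hp _ _.
assert (E : RS_sum g Theta n p xi = 0).
{ unfold RS_sum; rewrite (sum_eq _ (fun _ => 0)); [rewrite sum_cte; ring|].
  intros k Hk.
  pose proof (partition_in _ _ _ _ k Hp ltac:(lia)).
  pose proof (partition_in _ _ _ _ (S k) Hp ltac:(lia)).
  replace (p k) with c by lra; replace (p (S k)) with c by lra; ring. }
rewrite E, Rminus_0_r, Rabs_R0; lra.
Qed.

(** The two sums differ by the errors of [psi], weighted by [f]; these errors
    are absolutely summable to as little as desired. *)
Lemma is_RSInt_density (f psi Psi : R -> R) (c d A : R) :
  c <= d -> bounded_on (segment c d) f ->
  (forall x y : R, c <= x <= d -> c <= y <= d ->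
     is_RInt psi x y (Psi y - Psi x)) ->
  is_RSInt f Psi c d A ->
  is_RSInt (fun y => f y * psi y) (fun y => y) c d A.
Proof.
intros Hcd [M HM] HPsi HA.
destruct (Req_dec c d) as [<-|Hne].
{ rewrite (is_RSInt_inj _ _ _ _ _ _ HA (is_RSInt_point f Psi c)).
  apply is_RSInt_point. }
assert (HM0 : 0 <= M).
{ apply Rle_trans with (2 := HM c ltac:(unfold segment; lra)); apply Rabs_pos. }
intros eps Heps.
destruct (HA (eps / 2)) as (m1 & q1 & P1 & S1); [lra|].
destruct (fine_sum_absolute_errors psi Psi c d (eps / 2 / (M + 1)))
  as (delta & Hdelta & Serr); [lra|exact HPsi|apply Rdiv_lt_0_compat; lra|].
destruct (fine_partition c d delta Hcd Hdelta) as (m2 & q2 & P2 & Hmesh).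
destruct (partition_common_refinement _ _ _ _ _ _ P1 P2) as (m & q & Pq & R1 & R2).
exists m, q; split; [exact Pq|]; intros n p xi Pp Rp Hxi.
assert (Rtrans : forall m' q', refines m q m' q' -> refines n p m' q').
{ intros m' q' H j Hj; destruct (H j Hj) as (i & Hi & <-); now apply Rp. }
specialize (S1 n p xi Pp (Rtrans _ _ R1) Hxi).
specialize (Serr n p xi Pp
  (refines_mesh _ _ _ _ _ _ _ Hdelta P2 Pp (Rtrans _ _ R2) Hmesh) Hxi).
(* The factor M + 1, rather than M, makes the tolerance well defined when
   f vanishes. *)
assert (Hdiff : Rabs (RS_sum f Psi n p xi
    - RS_sum (fun y => f y * psi y) (fun y => y) n p xi) <= eps / 2).
{ unfold RS_sum; rewrite <- minus_sum.
  eapply Rle_trans; [apply sum_f_R0_triangle|].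
  apply Rle_trans with (sum_f_R0 (fun k => Rabs (Psi (p (S k)) - Psi (p k)
                        - psi (xi k) * (p (S k) - p k)) * (M + 1)) n).
  - apply sum_Rle; intros k Hk.
    replace (f (xi k) * (Psi (p (S k)) - Psi (p k))
             - f (xi k) * psi (xi k) * (p (S k) - p k))
      with ((Psi (p (S k)) - Psi (p k) - psi (xi k) * (p (S k) - p k)) * f (xi k))
      by ring.
    rewrite Rabs_mult; apply Rmult_le_compat_l; [apply Rabs_pos|].
    specialize (Hxi k Hk).
    pose proof (partition_in _ _ _ _ k Pp ltac:(lia)).
    pose proof (partition_in _ _ _ _ (S k) Pp ltac:(lia)).
    specialize (HM (xi k) ltac:(unfold segment; lra)); lra.
  - rewrite <- scal_sum.
    replace (eps / 2) with ((M + 1) * (eps / 2 / (M + 1))) by (field; lra).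
    apply Rmult_le_compat_l; lra. }
apply Rabs_le_between in S1; apply Rabs_le_between in Hdiff.
apply Rabs_le_between; lra.
Qed.

(** Every partition of [c, d] lifts along [Phi] to one of [a, b], and the image of a
    tagged partition finer than it has the same sum, term by term. *)
Lemma is_RSInt_comp (h Phi : R -> R) (a b c d A : R) :
  a <= b ->
  (forall x y : R, a <= x -> x <= y -> y <= b -> Phi x <= Phi y) ->
  Phi a = c -> Phi b = d ->
  (forall y : R, c <= y <= d -> exists x : R, a <= x <= b /\ Phi x = y) ->
  is_RSInt h (fun y => y) c d A ->
  is_RSInt (fun x => h (Phi x)) Phi a b A.
Proof.
intros Hab Hmon Ha Hb Hsurj HA eps Heps.
destruct (HA eps Heps) as (m & q & Pq & Sq).
assert (Hpre : forall y : R, exists x : R, c <= y <= d -> a <= x <= b /\ Phi x = y).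
{ intros y; destruct (Rle_dec c y) as [H1|H1]; [destruct (Rle_dec y d) as [H2|H2]|];
    [|exists 0; lra..].
  destruct (Hsurj y (conj H1 H2)) as (x & Hx); now exists x. }
apply functional_choice in Hpre; destruct Hpre as (pre & Hpre).
(* Imposing the endpoints is necessary: Phi may be constant near a or b. *)
pose (t := fun j : nat => if Nat.eq_dec j 0 then a
                          else if Nat.eq_dec j (S m) then b else pre (q j)).
assert (Ht : forall j, (j <= S m)%nat -> a <= t j <= b /\ Phi (t j) = q j).
{ intros j Hj; pose proof Pq as (H0 & H1 & _); unfold t.
  destruct (Nat.eq_dec j 0) as [->|_]; [split; [lra|congruence]|].
  destruct (Nat.eq_dec j (S m)) as [->|_]; [split; [lra|congruence]|].
  apply Hpre, (partition_in _ _ _ _ _ Pq Hj). }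
assert (Pt : is_partition a b m t).
{ split; [reflexivity|split].
  { unfold t; simpl; now destruct (Nat.eq_dec m m). }
  intros k Hk.
  destruct (Ht k ltac:(lia)) as [Hk1 Hk2], (Ht (S k) ltac:(lia)) as [HSk1 HSk2].
  pose proof Pq as (_ & _ & Hq); specialize (Hq k Hk).
  destruct (Req_dec (q k) (q (S k))) as [E|E].
  - unfold t; destruct (Nat.eq_dec k 0) as [->|_]; [exact (proj1 HSk1)|].
    destruct (Nat.eq_dec k (S m)) as [->|_]; [lia|].
    destruct (Nat.eq_dec (S k) 0) as [|_]; [lia|].
    destruct (Nat.eq_dec (S k) (S m)) as [_|_]; [|rewrite E; lra].
    destruct (Hpre (q k)) as [Hpk _]; [|lra].
    apply (partition_in _ _ _ _ _ Pq); lia.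
  - destruct (Rle_lt_dec (t k) (t (S k))) as [H|H]; [exact H|].
    pose proof (Hmon (t (S k)) (t k)); lra. }
exists m, t; split; [exact Pt|]; intros n p xi Pp Rp Hxi.
assert (Hin : forall k, (k <= S n)%nat -> a <= p k <= b).
{ intros k; apply (partition_in _ _ _ _ _ Pp). }
apply (Sq n (fun k => Phi (p k)) (fun k => Phi (xi k))).
- pose proof Pp as (H0 & H1 & Hp).
  split; [|split]; [congruence|congruence|].
  intros k Hk.
  apply Hmon; [apply Hin; lia|now apply Hp|apply Hin; lia].
- intros j Hj; destruct (Rp j Hj) as (i & Hi & E); exists i; split; [exact Hi|].
  rewrite E; now apply Ht.
- intros k Hk; specialize (Hxi k Hk).
  pose proof (Hin k ltac:(lia)); pose proof (Hin (S k) ltac:(lia)).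
  split; apply Hmon; lra.
Qed.

(** Read backwards, a tagged partition of [-d, -c] is the opposite of one of
    [c, d]. *)
Lemma is_RSInt_reflect (h : R -> R) (c d A : R) :
  is_RSInt h (fun y => y) c d A ->
  is_RSInt (fun y => h (- y)) (fun y => y) (- d) (- c) A.
Proof.
assert (Prev : forall c d n p, is_partition c d n p ->
    is_partition (- d) (- c) n (fun k => - p (S n - k)%nat)).
{ clear; intros c d n p (H0 & H1 & Hp); split; [|split].
  - now rewrite Nat.sub_0_r, H1.
  - now rewrite Nat.sub_diag, H0.
  - intros k Hk; specialize (Hp (n - k)%nat ltac:(lia)).
    replace (S n - S k)%nat with (n - k)%nat by lia.
    replace (S n - k)%nat with (S (n - k)) by lia; lra. }
intros HA eps Heps; destruct (HA eps Heps) as (m & q & Pq & Sq).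
exists m, (fun k => - q (S m - k)%nat); split; [now apply Prev|].
intros n p xi Pp Rp Hxi.
assert (E : RS_sum (fun y => h (- y)) (fun y => y) n p xi =
    RS_sum h (fun y => y) n (fun k => - p (S n - k)%nat) (fun k => - xi (n - k)%nat)).
{ unfold RS_sum; rewrite <- sum_f_R0_skip; apply sum_eq; intros k Hk.
  replace (S n - S k)%nat with (n - k)%nat by lia.
  replace (S n - k)%nat with (S (n - k)) by lia; ring. }
rewrite E; apply Sq.
- apply Prev in Pp; now rewrite !Ropp_involutive in Pp.
- intros j Hj; destruct (Rp (S m - j)%nat ltac:(lia)) as (i & Hi & Ei).
  exists (S n - i)%nat; split; [lia|].
  replace (S n - (S n - i))%nat with i by lia; rewrite Ei.
  replace (S m - (S m - j))%nat with j by lia; ring.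
- intros k Hk; specialize (Hxi (n - k)%nat ltac:(lia)).
  replace (S n - S k)%nat with (n - k)%nat by lia.
  replace (S n - k)%nat with (S (n - k)) by lia; lra.
Qed.

Lemma is_RSInt_opp_integrator (g Theta : R -> R) (c d A : R) :
  is_RSInt g (fun x => - Theta x) c d A -> is_RSInt g Theta c d (- A).
Proof.
intros HA eps Heps; destruct (HA eps Heps) as (m & q & Pq & Sq).
exists m, q; split; [exact Pq|]; intros n p xi Pp Rp Hxi.
specialize (Sq n p xi Pp Rp Hxi).
assert (E : RS_sum g (fun x => - Theta x) n p xi = - RS_sum g Theta n p xi).
{ unfold RS_sum; replace (- sum_f_R0 (fun k => g (xi k) * (Theta (p (S k)) - Theta (p k))) n)
    with ((-1) * sum_f_R0 (fun k => g (xi k) * (Theta (p (S k)) - Theta (p k))) n) by ring.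
  rewrite scal_sum; apply sum_eq; intros; ring. }
rewrite E in Sq.
replace (RS_sum g Theta n p xi - - A) with (- (- RS_sum g Theta n p xi - A)) by ring.
now rewrite Rabs_Ropp.
Qed.

(** * Indefinite integrals *)

Lemma indefinite_integral_increment (g F : R -> R) (c d s : R) :
  c <= s <= d -> ex_RInt g c d -> indefinite_integral (segment c d) s F g ->
  forall x y : R, c <= x <= d -> c <= y <= d -> is_RInt g x y (F y - F x).
Proof.
intros Hs Hg HF.
assert (Hfrom : forall x, c <= x <= d -> ex_RInt g c x).
{ intros x Hx; now apply (ex_RInt_Chasles_1 g c x d). }
assert (Hex : forall x y, c <= x <= d -> c <= y <= d -> ex_RInt g x y).
{ intros x y Hx Hy; apply ex_RInt_Chasles with c; [apply ex_RInt_swap|]; now apply Hfrom. }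
intros x y Hx Hy.
replace (F y - F x) with (RInt g x y); [now apply (RInt_correct (V := R_CompleteNormedModule)), Hex|].
rewrite (HF x Hx), (HF y Hy).
pose proof (RInt_Chasles g s x y (Hex s x Hs Hx) (Hex x y Hx Hy)) as E.
change (RInt g s x + RInt g x y = RInt g s y) in E; lra.
Qed.

Lemma indefinite_integral_increasing (phi Phi : R -> R) (a b : R) :
  a <= b -> ex_RInt phi a b -> indefinite_integral (segment a b) a Phi phi ->
  (forall x : R, segment a b x -> 0 <= phi x) ->
  forall x y : R, a <= x -> x <= y -> y <= b -> Phi x <= Phi y.
Proof.
intros Hab Hphi HPhi Hpos x y Hax Hxy Hyb.
pose proof (indefinite_integral_increment phi Phi a b a ltac:(lra) Hphi HPhi
  x y ltac:(lra) ltac:(lra)) as HI.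
pose proof (RInt_ge_0 phi x y Hxy (ex_intro _ _ HI)) as H.
rewrite (is_RInt_unique _ _ _ _ HI) in H.
enough (0 <= Phi y - Phi x) by lra.
apply H; intros t Ht; apply Hpos; unfold segment; lra.
Qed.

(** * Change of variable *)

Lemma is_RSInt_change_increasing (phi Phi h : R -> R) (a b c d A : R) :
  a <= b -> ex_RInt phi a b -> indefinite_integral (segment a b) a Phi phi ->
  (forall x : R, segment a b x -> 0 <= phi x) ->
  image_dir Phi (segment a b) =_D segment c d ->
  is_RSInt h (fun y => y) c d A ->
  Phi a = c /\ Phi b = d /\ is_RSInt (fun x => h (Phi x)) Phi a b A.
Proof.
intros Hab Hphi HPhi Hpos [Him1 Him2] HA.
pose proof (indefinite_integral_increasing phi Phi a b Hab Hphi HPhi Hpos) as Hmon.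
assert (Hin : forall x, a <= x <= b -> c <= Phi x <= d).
{ intros x Hx; apply Him1; now exists x. }
pose proof (Hin a ltac:(lra)); pose proof (Hin b ltac:(lra)).
assert (Ha : Phi a = c).
{ destruct (Him2 c) as (x & Ex & Hx); [unfold segment; lra|].
  pose proof (Hmon a x); unfold segment in Hx; lra. }
assert (Hb : Phi b = d).
{ destruct (Him2 d) as (x & Ex & Hx); [unfold segment; lra|].
  pose proof (Hmon x b); unfold segment in Hx; lra. }
split; [exact Ha|split; [exact Hb|]].
apply is_RSInt_comp with c d; auto.
intros y Hy; destruct (Him2 y Hy) as (x & -> & Hx); now exists x.
Qed.

Lemma is_RSInt_change_decreasing (phi Phi h : R -> R) (a b c d A : R) :
  a <= b -> ex_RInt phi a b -> indefinite_integral (segment a b) a Phi phi ->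
  (forall x : R, segment a b x -> phi x <= 0) ->
  image_dir Phi (segment a b) =_D segment c d ->
  is_RSInt h (fun y => y) c d A ->
  Phi a = d /\ Phi b = c /\ is_RSInt (fun x => h (Phi x)) Phi a b (- A).
Proof.
intros Hab Hphi HPhi Hneg [Him1 Him2] HA.
pose proof (indefinite_integral_increment phi Phi a b a ltac:(lra) Hphi HPhi) as HI.
destruct (is_RSInt_change_increasing (fun x => - phi x) (fun x => - Phi x)
  (fun y => h (- y)) a b (- d) (- c) A) as (Ha & Hb & HB).
- exact Hab.
- exact (ex_RInt_opp (V := R_NormedModule) phi a b Hphi).
- intros x Hx; unfold segment in Hx.
  pose proof (is_RInt_opp (V := R_NormedModule) _ _ _ _ (HI a x ltac:(lra) Hx)) as HO.
  change (is_RInt (fun y => - phi y) a x (- (Phi x - Phi a))) in HO.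
  rewrite (is_RInt_unique _ _ _ _ HO); simpl; ring.
- intros x Hx; specialize (Hneg x Hx); lra.
- split.
  + intros y (x & -> & Hx); assert (H : segment c d (Phi x)) by (apply Him1; now exists x).
    unfold segment in *; lra.
  + intros y Hy; destruct (Him2 (- y)) as (x & Ex & Hx); [unfold segment in *; lra|].
    exists x; split; [lra|exact Hx].
- now apply is_RSInt_reflect.
- split; [lra|split; [lra|]]; apply is_RSInt_opp_integrator.
  intros eps Heps; destruct (HB eps Heps) as (m & q & Pq & Sq).
  exists m, q; split; [exact Pq|]; intros n p xi Pp Rp Hxi.
  (* The integrand obtained is h (- - Phi x). *)
  specialize (Sq n p xi Pp Rp Hxi); unfold RS_sum in *.
  erewrite sum_eq; [exact Sq|]; intros k _; cbv beta; now rewrite Ropp_involutive.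
Qed.

Theorem mainTheorem1 :
  forall (a b : R) (phi Phi : R -> R) (c d : R) (psi Psi f : R -> R),
    a <= b ->
    bounded_on (segment a b) phi ->
    ex_RInt phi a b ->
    no_sign_change_on (segment a b) phi ->
    indefinite_integral (segment a b) a Phi phi ->
    image_dir Phi (segment a b) =_D segment c d ->
    bounded_on (segment c d) psi ->
    ex_RInt psi c d ->
    indefinite_integral (segment c d) (Phi a) Psi psi ->
    bounded_on (segment c d) f ->
    ex_RSInt f Psi c d ->
    ex_RSInt (fun x => f (Phi x) * psi (Phi x)) Phi a b /\
    RSInt f Psi (Phi a) (Phi b) =
      RSInt (fun x => f (Phi x) * psi (Phi x)) Phi a b.
Proof.
intros a b phi Phi c d psi Psi f Hab _ Hphi Hsign HPhi Him _ Hpsi HPsi Hf [A HA].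
assert (Hs : c <= Phi a <= d).
{ apply (proj1 Him); exists a; split; [reflexivity|unfold segment; lra]. }
assert (HD : is_RSInt (fun y => f y * psi y) (fun y => y) c d A).
{ apply is_RSInt_density with Psi; [lra|exact Hf| |exact HA].
  now apply indefinite_integral_increment with (Phi a). }
destruct Hsign as [Hpos|Hneg].
- destruct (is_RSInt_change_increasing phi Phi (fun y => f y * psi y) a b c d A)
    as (Ha & Hb & HB); try assumption.
  split; [now exists A|].
  rewrite Ha, Hb, (RSInt_unique _ _ _ _ _ Hab HB); apply RSInt_unique; [lra|exact HA].
- destruct (is_RSInt_change_decreasing phi Phi (fun y => f y * psi y) a b c d A)
    as (Ha & Hb & HB); try assumption.
  split; [now exists (- A)|].
  rewrite Ha, Hb, (RSInt_unique _ _ _ _ _ Hab HB).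
  destruct (Req_dec c d) as [<-|Hne]; [|apply RSInt_swap; [lra|exact HA]].
  (* On a single point the orientation is that of an increasing pair. *)
  assert (A = 0) as -> by exact (is_RSInt_inj _ _ _ _ _ _ HA (is_RSInt_point f Psi c)).
  rewrite Ropp_0; apply RSInt_unique; [lra|exact HA].
Qed.
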